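(* Let $(X,m)$ be a $\sigma$-finite measure space, let $p\in[1,\infty)$, and let $L$ be the infinitesimal generator of a strongly continuous, sub-Markovian semigroup $S=(S(t))_{t\ge 0}$ of bounded linear operators on $L^p(X,m)$. Let $f:[0,\infty)\to[0,\infty)$ be convex and continuous on $[0,\infty)$ with $f(0)=0$, $f(s)>0$ for all $s>0$, and $\int_1^\infty \frac{1}{f(s)}\,ds<\infty$. Let $F:(0,\infty)\to(0,\infty)$, $F(t)=\int_t^\infty \frac{1}{f(s)}\,ds$, which is a bijection with inverse $F^{-1}$. Let $a\in L^p(X,m)$ be nonnegative. Assume that there are a time $T>0$ and a measurable subset $G$ of $X$ with $m(G)>0$ such that $$(S(T)a)(x)>F^{-1}(T)\quad\text{for $m$-almost every }x\in G.$$ Then the initial value problem $u'=Lu+f(u)$, $u(0)=a$, $u\ge 0$, has no global mild solution. More precisely, $T$ is an upper bound on the existence time of a mild solution: if $u$ is a mild solution in an interval $I\subseteq[0,\infty)$ with $0\in I$, then $\sup I\le T$.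
   Context: $L^p(X,m)$ is the space of (equivalence classes of) real-valued $p$-integrable functions, and $L^p_+(X,m)$ is its subset of functions that are nonnegative $m$-almost everywhere. The semigroup $S$ is sub-Markovian if for every $t>0$ and every $\phi\in L^p(X,m)$ taking values in $[0,1]$ $m$-a.e., $S(t)\phi$ also takes values in $[0,1]$ $m$-a.e. The symbol $f$ also denotes the composition operator $f(\phi):=f\circ\phi$ with domain $D(f):=\{\phi\in L^p_+(X,m): f\circ\phi\in L^p(X,m)\}$. Let $I$ be an interval of nonnegative real numbers with $0\in I$. A function $u:I\to L^p_+(X,m)$ is a mild solution in $I$ of the initial value problem $u'=Lu+f(u)$, $u(0)=a$, $u\ge 0$, if $u(t)\in D(f)$ for all $t\in I\setminus\{0\}$, $f\circ u\in L^1((0,t];L^p(X,m))$ (Bochner integrable) for every $t\in I\setminus\{0\}$, and $$u(t)=S(t)a+\int_0^t S(t-s)f(u(s))\,ds\quad\text{for every }t\in I,$$ where the integral is a Bochner integral. If $I=[0,\infty)$, then $u$ is called a global mild solution. *)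

(* Defs.v *)
From HB Require Import structures.
From mathcomp Require Import all_boot all_order all_algebra.
From mathcomp Require Import all_classical all_reals all_analysis.
From mathcomp Require Import measurable_realfun ess_sup_inf.

Set Implicit Arguments.
Unset Strict Implicit.
Unset Printing Implicit Defensive.

Import Order.TTheory GRing.Theory Num.Def Num.Theory.
Import numFieldNormedType.Exports.

Local Open Scope classical_set_scope.
Local Open Scope ring_scope.

(** hoelder.v defines [LspaceType mu p1] as the a.e.-classes of measurable
    functions with finite p-norm, but without algebraic or metric structure.
    Here it is made a normed module: operations act on representatives. *)
Section Lspace_representatives.
Context d (X : measurableType d) (R : realType).
Variables (mu : {measure set X -> \bar R}) (p : \bar R) (p1 : (1 <= p)%E).

Local Notation V := (LspaceType mu p1).
Local Notation Lf := (LfunType mu p1).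
Local Open Scope quotient_scope.

Section to_mfun.
Variable f : Lf.
Definition Lfun_to_mfun_fun (x : X) : measurableTypeR R := f x.
Lemma Lfun_to_mfun_subproof : measurable_fun setT Lfun_to_mfun_fun.
Proof. exact: (@measurable_funPT _ _ _ _ f). Qed.
HB.instance Definition _ := isMeasurableFun.Build _ _ X (measurableTypeR R)
  Lfun_to_mfun_fun Lfun_to_mfun_subproof.
Definition Lfun_to_mfun : {mfun X >-> measurableTypeR R} := Lfun_to_mfun_fun.
Definition Lfun_class : {mfun_ mu, X >-> measurableTypeR R} :=
  \pi_{mfun_ mu, X >-> measurableTypeR R} Lfun_to_mfun.

Lemma Lfun_classE : \forall x \ae mu, Lfun_class x = f x :> R.
Proof.
have /eqmodP/asboolP : repr Lfun_class = Lfun_to_mfun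
   %[mod {mfun_ mu, X >-> measurableTypeR R}] by rewrite reprK.
by apply: filterS => x /(_ I).
Qed.
End to_mfun.


Lemma ae_eq_finite_Lnorm (f g : X -> R) :
  measurable_fun setT f -> measurable_fun setT g ->
  (\forall x \ae mu, f x = g x) ->
  'N[mu]_p[EFin \o f]%E = 'N[mu]_p[EFin \o g]%E.
Proof.
move=> mf mg fg; rewrite unlock /Lnorm; case: p p1 => [r _|_|//].
- congr (_ `^ _)%E; apply: ge0_ae_eq_integral => // [||x _|x _|].
  + apply: (measurableT_comp (measurable_poweR _)) => //.
    by apply: measurableT_comp => //; exact/measurable_EFinP.
  + apply: (measurableT_comp (measurable_poweR _)) => //.
    by apply: measurableT_comp => //; exact/measurable_EFinP.
  + exact: poweR_ge0.
  + exact: poweR_ge0.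
  + by apply: filterS fg => x /= fg _; rewrite fg.
- case: ifPn => // _; apply: eq_ess_sup.
  by apply: filterS fg => x /= ->.
Qed.

Lemma Lfun_class_finite (f : Lf) : finite_norm mu p (Lfun_class f : X -> R).
Proof.
rewrite /finite_norm (ae_eq_finite_Lnorm _ _ (Lfun_classE f)).
- exact: Lfunction_finite.
- exact: (@measurable_funPT _ _ _ _ (repr (Lfun_class f))).
- exact: measurable_funPT.
Qed.

HB.instance Definition _ (f : Lf) :=
  isFinLebesgue.Build d X R mu p p1 (Lfun_class f) (Lfun_class_finite f).

Definition Lclass (f : Lf) : V := Lfun_class f.

Section to_Lfun.
Variable v : V.
Definition Lspace_fun (x : X) : R := (v : {mfun_ mu, X >-> measurableTypeR R}) x.
Lemma Lspace_fun_measurable : measurable_fun setT Lspace_fun.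
Proof.
exact: (@measurable_funPT _ _ _ _ (repr (v : {mfun_ mu, X >-> measurableTypeR R}))).
Qed.
HB.instance Definition _ := isMeasurableFun.Build _ _ X R
  Lspace_fun Lspace_fun_measurable.
HB.instance Definition _ :=
  isLfunction.Build d X R mu p p1 Lspace_fun (@Lebesgue_finite _ _ _ _ _ _ v).
Definition Lrepr : Lf := Lspace_fun.
End to_Lfun.

Lemma LclassE (f : Lf) : \forall x \ae mu, Lrepr (Lclass f) x = f x.
Proof. exact: Lfun_classE. Qed.

Lemma Lspace_aeP (u v : V) : (\forall x \ae mu, Lrepr u x = Lrepr v x) -> u = v.
Proof.
move=> uv.
have : (u : {mfun_ mu, X >-> measurableTypeR R}) = v.
  rewrite -[LHS]reprK -[RHS]reprK; apply/eqmodP/asboolP.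
  by apply: filterS uv.
case: u v {uv} => [u [[cu]]] [v [[cv]]] /= uv.
by case: _ / uv cv => cv; rewrite (Prop_irrelevance cu cv).
Qed.

Lemma Lclass_eq (f g : Lf) : (\forall x \ae mu, f x = g x) -> Lclass f = Lclass g.
Proof.
move=> fg; apply: Lspace_aeP.
apply: filterS3 fg (LclassE f) (LclassE g) => x fg -> ->.
exact: fg.
Qed.

Lemma LreprK (v : V) : Lclass (Lrepr v) = v.
Proof. exact/Lspace_aeP/LclassE. Qed.

HB.instance Definition _ := gen_eqMixin V.
HB.instance Definition _ := gen_choiceMixin V.

Definition Lspace_zero : V := Lclass 0.
Definition Lspace_add (u v : V) : V := Lclass (Lrepr u + Lrepr v).
Definition Lspace_opp (u : V) : V := Lclass (- Lrepr u).
Definition Lspace_scale (a : R) (u : V) : V := Lclass (a *: Lrepr u).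
Definition Lspace_norm (u : V) : R := fine 'N[mu]_p[EFin \o Lrepr u]%E.

Lemma Lspace_addE (f g : Lf) : Lspace_add (Lclass f) (Lclass g) = Lclass (f + g).
Proof.
apply: Lclass_eq; apply: filterS2 (LclassE f) (LclassE g) => x fx gx.
by change (Lrepr (Lclass f) x + Lrepr (Lclass g) x = f x + g x); rewrite fx gx.
Qed.

Lemma Lspace_oppE (f : Lf) : Lspace_opp (Lclass f) = Lclass (- f).
Proof.
apply: Lclass_eq; apply: filterS (LclassE f) => x fx.
by change (- Lrepr (Lclass f) x = - f x); rewrite fx.
Qed.

Lemma Lspace_scaleE a (f : Lf) : Lspace_scale a (Lclass f) = Lclass (a *: f).
Proof.
apply: Lclass_eq; apply: filterS (LclassE f) => x fx.
by change (a * Lrepr (Lclass f) x = a * f x); rewrite fx.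
Qed.

Lemma Lspace_normE (f : Lf) :
  Lspace_norm (Lclass f) = fine 'N[mu]_p[EFin \o f]%E.
Proof.
congr fine; apply: ae_eq_finite_Lnorm (LclassE f); exact: measurable_funPT.
Qed.

Lemma Lspace_addA : associative Lspace_add.
Proof.
move=> u v w; rewrite -(LreprK u) -(LreprK v) -(LreprK w).
by rewrite !Lspace_addE addrA.
Qed.

Lemma Lspace_addC : commutative Lspace_add.
Proof.
by move=> u v; rewrite -(LreprK u) -(LreprK v) !Lspace_addE addrC.
Qed.

Lemma Lspace_add0 : left_id Lspace_zero Lspace_add.
Proof. by move=> u; rewrite -(LreprK u) Lspace_addE add0r. Qed.

Lemma Lspace_addN : left_inverse Lspace_zero Lspace_opp Lspace_add.
Proof. by move=> u; rewrite -(LreprK u) Lspace_oppE Lspace_addE addNr. Qed.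

HB.instance Definition _ := GRing.isZmodule.Build V
  Lspace_addA Lspace_addC Lspace_add0 Lspace_addN.

Lemma Lspace_scaleA a b u :
  Lspace_scale a (Lspace_scale b u) = Lspace_scale (a * b) u.
Proof. by rewrite -(LreprK u) !Lspace_scaleE scalerA. Qed.

Lemma Lspace_scale1 : left_id 1 Lspace_scale.
Proof. by move=> u; rewrite -(LreprK u) Lspace_scaleE scale1r. Qed.

Lemma Lspace_scaleDr : right_distributive Lspace_scale Lspace_add.
Proof.
move=> a u v; rewrite -(LreprK u) -(LreprK v).
by rewrite !(Lspace_scaleE, Lspace_addE) scalerDr.
Qed.

Lemma Lspace_scaleDl u :
  {morph Lspace_scale ^~ u : a b / a + b >-> Lspace_add a b}.
Proof.
by move=> a b; rewrite -(LreprK u) !(Lspace_scaleE, Lspace_addE) scalerDl.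
Qed.

HB.instance Definition _ := GRing.Zmodule_isLmodule.Build R V
  Lspace_scaleA Lspace_scale1 Lspace_scaleDr Lspace_scaleDl.

Lemma Lspace_ler_normD (u v : V) :
  Lspace_norm (u + v) <= Lspace_norm u + Lspace_norm v.
Proof.
change (u + v) with (Lspace_add u v).
by rewrite -(LreprK u) -(LreprK v) Lspace_addE !Lspace_normE; exact: ler_LnormD.
Qed.

Lemma Lspace_normrZ (a : R) (u : V) : Lspace_norm (a *: u) = `|a| * Lspace_norm u.
Proof.
change (a *: u) with (Lspace_scale a u).
rewrite -(LreprK u) Lspace_scaleE !Lspace_normE; apply: EFin_inj.
by rewrite EFinM !finite_norm_fine; exact: LnormZ.
Qed.

Lemma Lspace_normr0_eq0 (u : V) : Lspace_norm u = 0 -> u = 0.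
Proof.
move=> u0; have /fine_Lnormr_eq0 {}u0 := u0.
rewrite -(LreprK u); apply: Lclass_eq.
by apply: filterS u0 => x /(_ I).
Qed.

HB.instance Definition _ := Lmodule_isNormed.Build R V
  Lspace_ler_normD Lspace_normrZ Lspace_normr0_eq0.

Lemma Lspace_normrE (u : V) : `|u| = fine ('N[mu]_p[EFin \o Lrepr u]%E).
Proof. by []. Qed.

End Lspace_representatives.

Section bochner.
Context d (T : measurableType d) (R : realType).
Variables (mu : {measure set T -> \bar R}) (V : normedModType R).
Implicit Types (D : set T) (f : T -> V).

Definition integrable_step D (s : {fimfun T >-> V}) :=
  forall v : V, v != 0 -> measurable (D `&` s @^-1` [set v]) /\
                          (mu (D `&` s @^-1` [set v]) < +oo)%E.

Definition step_integral D (s : {fimfun T >-> V}) : V :=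
  \sum_(v \in range s) fine (mu (D `&` s @^-1` [set v])) *: v.

Definition bochner_approx D f (s : nat -> {fimfun T >-> V}) :=
  [/\ forall n, integrable_step D (s n),
      \forall x \ae mu, D x -> s n x @[n --> \oo] --> f x &
      (\int[mu]_(x in D) `|f x - s n x|%:E)%E @[n --> \oo] --> 0%E].

Definition bochner_integrable D f := exists s, bochner_approx D f s.

(** [v] is the value of the Bochner integral of [f] over [D]; a relation, so
    that no default value is needed for non-integrable [f]. *)
Definition is_bochner_integral D f (v : V) :=
  exists2 s, bochner_approx D f s & step_integral D (s n) @[n --> \oo] --> v.

End bochner.

Section semigroup.
Context (R : realType) (V : normedModType R).
(** Only the values [S t] for [0 <= t] are meaningful. *)
Variable S : R -> {linear V -> V}.

Definition strongly_continuous_semigroup :=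
  [/\ forall t, 0 <= t -> exists M : R, forall x, `|S t x| <= M * `|x|,
      forall x, S 0 x = x,
      forall s t, 0 <= s -> 0 <= t -> forall x, S (s + t) x = S s (S t x) &
      forall x, {within `[0, +oo[, continuous (fun t => S t x)}].

(** The generator is the partial operator [L] with domain [DL]. *)
Definition infinitesimal_generator (DL : set V) (L : V -> V) :=
  DL = [set x | cvg (h^-1 *: (S h x - x) @[h --> 0^'+])] /\
  forall x, DL x -> h^-1 *: (S h x - x) @[h --> 0^'+] --> L x.

End semigroup.

Section mild_solution.
Context d (X : measurableType d) (R : realType).
Variables (m : {measure set X -> \bar R}) (p : \bar R) (p1 : (1 <= p)%E).
Local Notation Lp := (LspaceType m p1).
Variables (S : R -> {linear Lp -> Lp}) (f : R -> R).

Definition sub_markovian := forall t, 0 < t -> forall phi : Lp,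
  (\forall x \ae m, 0 <= Lrepr phi x <= 1) ->
  \forall x \ae m, 0 <= Lrepr (S t phi) x <= 1.

Definition Lspace_nneg (phi : Lp) := \forall x \ae m, 0 <= Lrepr phi x.

Definition is_superposition (phi psi : Lp) :=
  \forall x \ae m, Lrepr psi x = f (Lrepr phi x).

Definition superposition_dom : set Lp :=
  [set phi | Lspace_nneg phi /\ exists psi, is_superposition phi psi].

(** The class of [f \o phi]; it is unique when it exists, and the value is [0]
    outside the domain. *)
Definition superposition (phi : Lp) : Lp :=
  xget 0 [set psi | is_superposition phi psi].

Definition mild_solution (a : Lp) (I : set R) (u : R -> Lp) :=
  [/\ forall t, I t -> Lspace_nneg (u t),
      forall t, I t -> t != 0 -> superposition_dom (u t),
      forall t, I t -> t != 0 -> bochner_integrable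
        (lebesgue_measure : {measure set (measurableTypeR R) -> \bar R})
        `]0, t]%classic (fun s => superposition (u s)) &
      forall t, I t -> exists2 v, is_bochner_integral
        (lebesgue_measure : {measure set (measurableTypeR R) -> \bar R})
        `]0, t]%classic (fun s => S (t - s) (superposition (u s))) v &
        u t = S t a + v].

End mild_solution.

Section reciprocal_tail.
Context (R : realType) (f : R -> R).

Definition reciprocal_tail (t : R) : R :=
  \int[lebesgue_measure]_(s in `[t, +oo[) (f s)^-1.

(** The inverse of the restriction of [reciprocal_tail] to (0, +oo). *)
Definition reciprocal_tail_inv : R -> R :=
  'pinv_(fun=> 0) `]0, +oo[ reciprocal_tail.

End reciprocal_tail.

(* Main.v *)
Require Import Defs.
From HB Require Import structures.
From mathcomp Require Import all_boot all_order all_algebra.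
From mathcomp Require Import all_classical all_reals all_analysis.
From mathcomp Require Import measurable_realfun ring lra.

Set Implicit Arguments.
Unset Strict Implicit.
Unset Printing Implicit Defensive.

Import Order.TTheory GRing.Theory Num.Def Num.Theory.
Import numFieldNormedType.Exports.

Local Open Scope classical_set_scope.
Local Open Scope ring_scope.

(** Suppose that a mild solution [u] lives up to time [T] and transport it to
    time [T] by the semigroup: [v t = S (T - t) (u t)]. Applying [S (T - t)] to
    Duhamel's formula gives [v t = S T a + int_0^t S (T - s) (f (u s)) ds], and
    Jensen's inequality for the sub-Markovian operator [S (T - s)] and the
    convex function [f], which vanishes at 0, gives
    [S (T - s) (f (u s)) >= f (v s)]. So at almost every point [v] grows at
    least as fast as the solution of [y' = f y] that starts at
    [y0 = (S T a) x]. Let [F] be the tail integral of [1 / f]. Since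
    [F y0 - F (y t) = t] along that solution and [F] is positive, reaching time
    [T] requires [F y0 > T], that is [(S T a) x < F^-1 T], almost everywhere.
    This contradicts the hypothesis on the non-null set [G].

    Making this pointwise would need a version of [v] that is jointly
    measurable in time and space. Two devices avoid it. First, inequalities
    between increments of [v] are established by testing with the functionals
    [phi |-> int_E phi dm], [E] of finite measure. They turn Bochner integrals
    into Lebesgue integrals ([bochner_integral_scalar], [bochner_increment]) and
    detect the order of [L^p] because [m] is sigma-finite
    ([ae_ge_set_integral]). Jensen's inequality is used one affine minorant of
    [f] at a time ([sub_markovian_affine]); the supporting lines at rational
    points suffice to recover [f] outside of one null set
    ([transported_euler_step]). Secondly, the differential inequality is
    replaced by the countably many explicit Euler schemes with step [T / n]:
    an orbit of such a scheme loses almost [T / n] of [F] at each step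
    ([euler_step_tail]), which in the limit yields [F y0 >= T + F M > T] when
    the orbits stay below [M] ([euler_blowup]). *)

(** * Convex nonlinearities vanishing at zero *)

Section convex_nonlinearity.
Context (R : realType) (f : R -> R).
Hypothesis f_convex : convex_function (`[0, +oo[%classic : set R) f.
Hypothesis f0 : f 0 = 0.
Hypothesis f_gt0 : forall s : R, 0 < s -> 0 < f s.

Lemma three_chord x y z : 0 <= x -> x <= y -> y <= z ->
  (z - x) * f y <= (z - y) * f x + (y - x) * f z.
Proof.
move=> x0 xy yz.
have [xz|zx] := ltP x z; last first.
  have -> : y = x by lra.
  by have -> : z = x; [lra|rewrite !subrr !mul0r addr0].
have t01 : 0 <= (z - y) / (z - x) <= 1.
  by rewrite divr_ge0 ?ler_pdivrMr /=; lra.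
have fxz : f ((z - y) / (z - x) * x + (1 - (z - y) / (z - x)) * z) <=
    (z - y) / (z - x) * f x + (1 - (z - y) / (z - x)) * f z.
  apply: (f_convex (Itv01 (andP t01).1 (andP t01).2));
    by rewrite inE /= in_itv /= andbT; lra.
have zx0 : 0 < z - x by lra.
have yE : (z - y) / (z - x) * x + (1 - (z - y) / (z - x)) * z = y.
  by field; lra.
rewrite yE in fxz.
rewrite -(ler_pM2l zx0) in fxz; apply: (le_trans fxz).
by rewrite le_eqVlt; apply/orP; left; apply/eqP; field; lra.
Qed.

Lemma convex_ge0 x : 0 <= x -> 0 <= f x.
Proof. by rewrite le_eqVlt => /predU1P[<-|/f_gt0/ltW//]; rewrite f0. Qed.

Lemma convex_star x y : 0 <= x -> x <= y -> y * f x <= x * f y.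
Proof.
move=> x0 xy; have := three_chord (lexx 0) x0 xy.
by rewrite f0 !subr0 mulr0 add0r.
Qed.

Lemma convex_mono x y : 0 <= x -> x <= y -> f x <= f y.
Proof.
move=> x0 xy; have [y0|y0] := ltP 0 y; last first.
  by have -> : x = y; [lra|].
have := convex_star x0 xy; have := convex_ge0 (ltW y0).
by move=> fy0 sxy; rewrite -(ler_pM2l y0); nra.
Qed.

(** Slopes of chords increase, and the chord over [y, M + 1] has slope at most
    [f (M + 1)] because its horizontal length is at least 1. *)
Lemma convex_lipschitz x y M : 0 <= x -> x <= y -> y <= M ->
  f y - f x <= f (M + 1) * (y - x).
Proof.
move=> x0 xy yM; have yM1 : y <= M + 1 by lra.
have := three_chord x0 xy yM1.
have := convex_mono x0 xy; have := convex_ge0 (le_trans x0 xy).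
by nra.
Qed.

(** The slope is the right derivative of [f] at [q]. *)
Lemma convex_supporting_line q : 0 < q ->
  exists2 al, f q <= al * q & forall y, 0 <= y -> f q + al * (y - q) <= f y.
Proof.
move=> q0.
pose A := [set (f r - f q) / (r - q) | r in [set r | q < r]].
have lbA s : 0 <= s -> s < q -> lbound A ((f q - f s) / (q - s)).
  move=> s0 sq _ [r /= qr <-].
  rewrite ler_pdivrMr ?subr_gt0// mulrAC ler_pdivlMr ?subr_gt0//.
  by have := three_chord s0 (ltW sq) (ltW qr); lra.
have A0 : A !=set0.
  by exists ((f (q + 1) - f q) / (q + 1 - q)); exists (q + 1) => //=; lra.
have infA : has_inf A.
  by split => //; exists ((f q - f 0) / (q - 0)); exact: lbA.
exists (inf A).
  have := lb_le_inf A0 (lbA _ (lexx 0) q0).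
  by rewrite f0 !subr0 ler_pdivrMr.
move=> y y0; have [yq|qy|->] := ltgtP y q; last by rewrite subrr mulr0 addr0.
  have := lb_le_inf A0 (lbA _ y0 yq).
  by rewrite ler_pdivrMr ?subr_gt0//; lra.
have : inf A <= (f y - f q) / (y - q).
  by apply: ge_inf => //; [case: infA|exists y].
by rewrite ler_pdivlMr ?subr_gt0//; lra.
Qed.

End convex_nonlinearity.

(** * The tail integral of the reciprocal *)

Section reciprocal_tail_properties.
Context (R : realType) (f : R -> R).
Hypothesis f_convex : convex_function (`[0, +oo[%classic : set R) f.
Hypothesis f_continuous : {within `[0, +oo[, continuous f}.
Hypothesis f0 : f 0 = 0.
Hypothesis f_gt0 : forall s : R, 0 < s -> 0 < f s.
Hypothesis f_int :
  (\int[lebesgue_measure]_(s in `[1%R, +oo[) ((f s)^-1)%R%:E < +oo)%E.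

Local Notation F := (reciprocal_tail f).
Local Notation mu := (@lebesgue_measure R).

Lemma measurable_reciprocal (D : set R) : measurable D -> D `<=` `]0, +oo[ ->
  measurable_fun D (fun s => (f s)^-1).
Proof.
move=> mD D0.
suff mf : measurable_fun (`]0, +oo[ : set R) (fun s => (f s)^-1).
  exact: measurable_funS mf.
apply: (eq_measurable_fun (fun s => (f s) `^ (-1))).
  move=> s; rewrite inE /= in_itv /= andbT => s0.
  by rewrite powR_inv1// ltW// f_gt0.
apply: (measurableT_comp (measurable_powR _)).
apply: subspace_continuous_measurable_fun => //.
apply: continuous_subspaceW f_continuous.
by move=> s /=; rewrite !in_itv /= !andbT => /ltW.
Qed.

Lemma reciprocal_bound x s : 0 < x -> x <= s -> (f s)^-1 <= (f x)^-1.
Proof.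
move=> x0 xs; rewrite lef_pV2 ?posrE ?f_gt0//; last exact: lt_le_trans xs.
exact: (convex_mono f_convex f0 f_gt0 (ltW x0)).
Qed.

Lemma integrable_reciprocal x : 0 < x ->
  mu.-integrable `[x, +oo[ (EFin \o (fun s => (f s)^-1)).
Proof.
move=> x0; pose M := Num.max x 1.
have xM : x <= M by rewrite le_max lexx.
have M1 : 1 <= M by rewrite le_max lexx orbT.
have sub : (`[x, +oo[%classic : set R) `<=` `]0, +oo[.
  by move=> s /=; rewrite !in_itv /= !andbT; apply: lt_le_trans.
have ge0 s : x <= s -> 0 <= (f s)^-1.
  by move=> xs; rewrite invr_ge0 ltW// f_gt0//; exact: lt_le_trans xs.
apply/integrableP; split.
  by apply/measurable_EFinP; exact: measurable_reciprocal.
rewrite [ltLHS](_ : _ = \int[mu]_(s in `[x, +oo[) ((f s)^-1)%:E)%E; last first.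
  apply: eq_integral => s; rewrite inE /= in_itv /= andbT => xs.
  by rewrite ger0_norm// ge0.
have itvU : `[x, +oo[%classic = `[x, M[ `|` `[M, +oo[ :> set R.
  by rewrite -itv_bndbnd_setU// bnd_simp.
rewrite itvU ge0_integral_setU//=; first last.
- apply/disj_setPS => s [/=]; rewrite !in_itv /= => /andP[_ sM] /andP[].
  by rewrite leNgt sM.
- move=> s [] /=; rewrite in_itv /= lee_fin; first by move=> /andP[/ge0].
  by rewrite andbT => Ms; rewrite ge0// (le_trans xM).
- apply/measurable_EFinP; apply: measurable_reciprocal.
    exact: measurableU.
  move=> s [] /=; rewrite !in_itv /= !andbT.
    by move=> /andP[/(lt_le_trans x0)].
  exact/lt_le_trans/(lt_le_trans x0).
apply: lte_add_pinfty.
  apply: (@le_lt_trans _ _ (\int[mu]_(s in `[x, M[) ((f x)^-1)%:E)%E).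
    apply: ge0_le_integral => //.
    - by move=> s /=; rewrite in_itv /= lee_fin => /andP[/ge0].
    - apply/measurable_EFinP; apply: measurable_reciprocal => [//|s /=].
      by rewrite !in_itv /= andbT => /andP[/(lt_le_trans x0)].
    - move=> s /=; rewrite in_itv /= lee_fin => /andP[xs _].
      exact: reciprocal_bound.
  rewrite integral_cst//= lebesgue_measure_itv /= lte_fin.
  by case: ifP; rewrite ?mule0 // -EFinB -EFinM ltry.
apply: le_lt_trans f_int; apply: ge0_subset_integral => //=.
- apply/measurable_EFinP; apply: measurable_reciprocal => [//|s /=].
  by rewrite !in_itv /= !andbT; apply: lt_le_trans.
- move=> s; rewrite in_itv /= andbT lee_fin invr_ge0 => s1.
  by rewrite ltW// f_gt0//; exact: lt_le_trans s1.
- by move=> s /=; rewrite !in_itv /= !andbT; apply: le_trans.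
Qed.

Lemma reciprocal_tail_split x y : 0 < x -> x <= y ->
  F x - F y = \int[mu]_(s in `[x, y[) (f s)^-1.
Proof.
move=> x0 xy; rewrite /reciprocal_tail.
have -> : [set` `[x, +oo[] = `[x, y[ `|` `[y, +oo[ :> set R.
  by rewrite -itv_bndbnd_setU// bnd_simp.
rewrite Rintegral_setU ?addrK//.
  rewrite -itv_bndbnd_setU ?bnd_simp//; exact: integrable_reciprocal.
apply/disj_setPS => s [/=]; rewrite !in_itv /= => /andP[_ sy] /andP[].
by rewrite leNgt sy.
Qed.

Lemma reciprocal_tail_bounds x y : 0 < x -> x <= y ->
  (y - x) / f y <= F x - F y <= (y - x) / f x.
Proof.
move=> x0 xy; rewrite reciprocal_tail_split//.
have int_cst r : mu.-integrable `[x, y[ (EFin \o cst r).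
  apply: measurable_bounded_integrable => //=.
    by rewrite lebesgue_measure_itv /=; case: ifP; rewrite // -EFinB ltry.
  by exists `|r|; split; [exact: num_real|move=> M rM s _; exact: ltW].
have intf : mu.-integrable `[x, y[ (EFin \o (fun s => (f s)^-1)).
  apply: integrableS (integrable_reciprocal x0) => // s /=.
  by rewrite !in_itv /= andbT => /andP[].
have int_r r : (y - x) / r = \int[mu]_(s in `[x, y[) r^-1.
  rewrite Rintegral_cst// [RHS]mulrC; congr (_ * _).
  have muE : mu `[x, y[ = (y - x)%:E.
    rewrite lebesgue_measure_itv /= lte_fin.
    by case: ltgtP xy => // ->; rewrite subrr.
  exact: (congr1 fine (esym muE)).
rewrite !int_r; apply/andP; split; apply: le_Rintegral => //;
  try exact: int_cst; move=> s /=; rewrite in_itv /= => /andP[xs sy].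
- exact/reciprocal_bound/ltW/sy/(lt_le_trans x0 xs).
- exact: reciprocal_bound.
Qed.

Lemma reciprocal_tail_ge0 x : 0 < x -> 0 <= F x.
Proof.
move=> x0; apply: Rintegral_ge0 => s /=; rewrite in_itv /= andbT => xs.
by rewrite invr_ge0 ltW// f_gt0//; exact: lt_le_trans xs.
Qed.

Lemma reciprocal_tail_gt0 x : 0 < x -> 0 < F x.
Proof.
move=> x0; have /andP[lb _] := @reciprocal_tail_bounds x (x + 1) x0 ltac:(lra).
have x10 : 0 < x + 1 by lra.
have := reciprocal_tail_ge0 x10.
have : 0 < (x + 1 - x) / f (x + 1) by rewrite divr_gt0 ?f_gt0//; lra.
lra.
Qed.

Lemma reciprocal_tail_mono x y : 0 < x -> x <= y -> F y <= F x.
Proof.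
move=> x0 xy; have /andP[lb _] := reciprocal_tail_bounds x0 xy.
have : 0 <= (y - x) / f y.
  by rewrite divr_ge0 ?subr_ge0// ltW// f_gt0//; exact: lt_le_trans xy.
lra.
Qed.

(** Each dyadic interval contributes at least [(2 f 1)^-1], because
    [f s <= s f 1] on [0, 1]. *)
Lemma reciprocal_tail_dyadic k : k%:R / (2 * f 1) <= F (2^-1 ^+ k).
Proof.
elim: k => [|k IH]; first by rewrite mul0r reciprocal_tail_ge0// expr0.
have p0 n : 0 < (2^-1 : R) ^+ n by rewrite exprn_gt0// invr_gt0.
have kk : (2^-1 : R) ^+ k.+1 <= 2^-1 ^+ k.
  by rewrite exprS; have := p0 k; lra.
have /andP[lb _] := reciprocal_tail_bounds (p0 k.+1) kk.
have k1 : (2^-1 : R) ^+ k <= 1 by rewrite exprn_ile1//; lra.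
have fk := convex_star f_convex f0 (ltW (p0 k)) k1.
have f1 : 0 < f 1 by exact: f_gt0.
have : 1 / (2 * f 1) <= (2^-1 ^+ k - 2^-1 ^+ k.+1) / f (2^-1 ^+ k).
  rewrite ler_pdivrMr ?mulr_gt0// mulrAC ler_pdivlMr ?f_gt0// exprS.
  rewrite [leRHS](_ : _ = 2^-1 ^+ k * f 1); last by field.
  exact: fk.
move=> step; rewrite -natr1 mulrDl addrC.
by rewrite -(subrK (F (2^-1 ^+ k)) (F (2^-1 ^+ k.+1))) lerD// (le_trans step).
Qed.

Lemma reciprocal_tail_small e : 0 < e -> exists2 y, 0 < y & F y < e.
Proof.
move=> e0.
have int1 := integrable_reciprocal (@ltr01 R).
pose I n : set R := `[1, n.+1%:R]%classic.
have mI n : measurable (I n) by exact: measurable_itv.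
have sub n : I n `<=` `[1, +oo[.
  by move=> s; rewrite /I /= !in_itv /= andbT => /andP[].
have nd : nondecreasing_seq I.
  move=> n k nk; rewrite subsetEset => s.
  rewrite /I /= !in_itv /= => /andP[-> sn] /=.
  by rewrite (le_trans sn)// ler_nat.
have mIf n : measurable_fun (I n) (fun s => ((f s)^-1)%:E).
  apply/measurable_EFinP; apply: measurable_reciprocal => // s /sub /=.
  by rewrite !in_itv /= !andbT; apply: lt_le_trans.
have ge0 n s : I n s -> (0 <= ((f s)^-1)%:E)%E.
  move=> /sub /=; rewrite in_itv /= andbT => s1.
  by rewrite lee_fin invr_ge0 ltW// f_gt0//; exact: lt_le_trans s1.
have cvgF := @ge0_nondecreasing_set_cvg_integral _ _ R _ _ mu nd mI mIf ge0.
have IU : \bigcup_n I n = `[1, +oo[%classic.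
  apply/seteqP; split => [s [n _] /sub//|s /=].
  rewrite in_itv /= andbT => s1; exists (Num.truncn s) => //=.
  by rewrite /I /= in_itv /= s1 ltW// truncnS_gt.
rewrite IU in cvgF.
have : \int[mu]_(s in I n) (f s)^-1 @[n --> \oo] --> F 1.
  by apply: fine_cvg; rewrite fineK//; exact: integrable_fin_num.
move=> /cvgrPdist_lt /(_ e e0) [n _ /(_ n (leqnn n)) /= dist].
have n1 : (1 : R) <= n.+1%:R by rewrite ler1n.
exists n.+1%:R; first exact: lt_le_trans n1.
have := reciprocal_tail_split ltr01 n1.
rewrite Rintegral_itv_bndo_bndc; last first.
  by apply: integrableS int1 => // s /=; rewrite !in_itv /= andbT => /andP[].
by move: dist; rewrite ltr_norml => /andP[_]; lra.
Qed.

(** [F] maps onto (0, +oo): it is locally Lipschitz, unbounded near 0 by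
    convexity and small at infinity by integrability. *)
Lemma reciprocal_tail_invK T : 0 < T ->
  0 < reciprocal_tail_inv f T /\ F (reciprocal_tail_inv f T) = T.
Proof.
move=> T0.
have [y y0 Fy] := reciprocal_tail_small T0.
have [x x0 [xy Fx]] : exists2 x, 0 < x & x <= y /\ T <= F x.
  pose k := Num.truncn (T * (2 * f 1)).
  have f1 : 0 < f 1 by exact: f_gt0.
  have Tk : T <= F (2^-1 ^+ k.+1).
    apply: le_trans (reciprocal_tail_dyadic k.+1).
    by rewrite ler_pdivlMr ?mulr_gt0// ltW// truncnS_gt.
  have p0 : 0 < (2^-1 : R) ^+ k.+1 by rewrite exprn_gt0// invr_gt0.
  exists (Num.min y (2^-1 ^+ k.+1)); first by rewrite lt_min y0.
  split; first by rewrite ge_min lexx.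
  by apply: (le_trans Tk); apply: reciprocal_tail_mono;
     rewrite ?lt_min ?y0// ge_min lexx orbT.
have cF : {within `[x, y], continuous F}.
  apply: continuous_in_subspaceT => c; rewrite inE /= in_itv /= => /andP[xc _].
  have c20 : 0 < c / 2 by lra.
  have fc := f_gt0 c20.
  apply/cvgrPdist_le => e e0; near=> z.
  have cz : c / 2 <= z.
    near: z; exists (c / 2) => // z /=; rewrite ltr_norml => /andP[_]; lra.
  have dist a b : c / 2 <= a -> a <= b -> `|b - a| <= e * f (c / 2) ->
      `|F a - F b| <= e.
    move=> ca ab; have a0 := lt_le_trans c20 ca.
    have /andP[_ ub] := reciprocal_tail_bounds a0 ab.
    have Fba := reciprocal_tail_mono a0 ab.
    rewrite !ger0_norm ?subr_ge0// => ba; apply: (le_trans ub).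
    rewrite ler_pdivrMr ?f_gt0//; apply: (le_trans ba); rewrite ler_pM2l//.
    exact: (convex_mono f_convex f0 f_gt0 (ltW c20) ca).
  have zc : `|z - c| <= e * f (c / 2).
    near: z; exists (e * f (c / 2)) => [|z /=]; first exact: mulr_gt0.
    by rewrite distrC => /ltW.
  have [cz'|zc'] := leP c z; first by apply: dist => //; lra.
  by rewrite distrC; apply: dist; rewrite ?(ltW zc')// distrC.
have [c] : exists2 c, c \in `[x, y] & F c = T.
  apply: IVT => //; rewrite le_max ge_min Fx (ltW Fy) !orbT //.
rewrite in_itv /= => /andP[xc _] Fc.
have surjF : set_surj `]0, +oo[ [set T] F.
  by move=> _ ->; exists c => //=; rewrite in_itv /= andbT (lt_le_trans x0).
split; last by rewrite /reciprocal_tail_inv (surjpK _ surjF)// inE.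
have /(_ (reciprocal_tail_inv f T)) :=
  @surjpinv_image_sub _ _ (fun=> 0) _ _ _ surjF.
by rewrite /= in_itv /= andbT; apply; exists T.
Unshelve. all: by end_near.
Qed.

End reciprocal_tail_properties.

(** * Blow-up of Euler schemes *)

Section euler_scheme.
Context (R : realType) (f : R -> R).
Hypothesis f_convex : convex_function (`[0, +oo[%classic : set R) f.
Hypothesis f_continuous : {within `[0, +oo[, continuous f}.
Hypothesis f0 : f 0 = 0.
Hypothesis f_gt0 : forall s : R, 0 < s -> 0 < f s.
Hypothesis f_int :
  (\int[lebesgue_measure]_(s in `[1%R, +oo[) ((f s)^-1)%R%:E < +oo)%E.

Local Notation F := (reciprocal_tail f).

Definition euler_step (h z : R) := z + h * f z.

Lemma euler_step_tail h z M : 0 < h -> 0 < z -> euler_step h z <= M ->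
  h / (1 + h * f (M + 1)) <= F z - F (euler_step h z).
Proof.
move=> h0 z0 zM; set z' := euler_step h z.
have fz0 := f_gt0 z0.
have zz' : z <= z' by rewrite lerDl mulr_ge0// ltW.
have z'0 := lt_le_trans z0 zz'.
have fz'0 := f_gt0 z'0.
have M0 : 0 < f (M + 1).
  by apply: f_gt0; have := lt_le_trans z'0 zM; lra.
have /andP[lb _] :=
  reciprocal_tail_bounds f_convex f_continuous f0 f_gt0 f_int z0 zz'.
apply: le_trans lb.
have := convex_lipschitz f_convex f0 f_gt0 (ltW z0) zz' zM.
have -> : z' - z = h * f z by rewrite /z' /euler_step; ring.
move=> lip.
have D0 : 0 < 1 + h * f (M + 1) by rewrite ltr_pwDl// mulr_ge0// ltW.
rewrite ler_pdivrMr// mulrAC ler_pdivlMr// -mulrA ler_pM2l//.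
move: lip; lra.
Qed.

(** Along an exact orbit of the explicit Euler scheme the value of [F] drops at
    each step by almost the step size, so a scheme that stays bounded during
    time [T] for every step size [T / n] forces [F y0 >= T + F M]. *)
Lemma euler_blowup T y0 M (y : nat -> nat -> R) : 0 < T -> 0 < y0 ->
  (forall n, y n 0%N = y0) -> (forall n, y n n.+1 = M) ->
  (forall n k, (k <= n)%N -> 0 < y n k ->
     euler_step (T / n.+1%:R) (y n k) <= y n k.+1) ->
  T < F y0.
Proof.
move=> T0 y00 yn0 ynM ystep.
have orbit n : exists2 z, y0 <= z <= M &
    T / (1 + T / n.+1%:R * f (M + 1)) <= F y0 - F z.
  set h := T / n.+1%:R.
  have h0 : 0 < h by rewrite divr_gt0.
  pose z k := iter k (euler_step h) y0.
  have z_mono k : 0 < z k -> z k <= z k.+1.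
    by move=> zk; rewrite lerDl mulr_ge0 ?ltW ?f_gt0.
  have zy0 k : y0 <= z k.
    by elim: k => //= k IH; rewrite (le_trans IH)// z_mono// (lt_le_trans y00).
  have z0 k : 0 < z k by exact: lt_le_trans (zy0 k).
  have z_le k : (k <= n.+1)%N -> z k <= y n k.
    elim: k => [_|k IH kn]; first by rewrite yn0.
    have zyk := IH (ltnW kn).
    apply: le_trans (ystep n k kn (lt_le_trans (z0 k) zyk)).
    rewrite /= /euler_step lerD// ler_pM2l//.
    exact: (convex_mono f_convex f0 f_gt0 (ltW (z0 k))).
  have z_homo j k : (j <= k)%N -> z j <= z k.
    move=> /subnK <-; elim: (k - j)%N => // i IH.
    by rewrite (le_trans IH)// z_mono.
  have zM : z n.+1 <= M by rewrite -(ynM n) z_le.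
  exists (z n.+1); first by rewrite zy0.
  have drop k : (k <= n.+1)%N ->
      k%:R * (h / (1 + h * f (M + 1))) <= F y0 - F (z k).
    elim: k => [_|k IH kn]; first by rewrite mul0r subrr.
    rewrite -natr1 mulrDl mul1r.
    have := euler_step_tail h0 (z0 k) (le_trans (z_homo k.+1 n.+1 kn) zM).
    have := IH (ltnW kn); rewrite /z /=; lra.
  have := drop n.+1 (leqnn _).
  by rewrite mulrA /h (mulrC n.+1%:R) divfK.
have M0 : 0 < M.
  by have [z /andP[y0z zM] _] := orbit 0%N; lra.
have C0 : 0 < f (M + 1) by apply: f_gt0; lra.
have FM := reciprocal_tail_gt0 f_convex f_continuous f0 f_gt0 f_int M0.
(* with this many steps the loss [T - T / (1 + e)] is less than [F M] *)
pose n := Num.truncn (T ^+ 2 * f (M + 1) / F M).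
have [z /andP[y0z zM] Fz] := orbit n.
have FzM := reciprocal_tail_mono f_convex f_continuous f0 f_gt0 f_int
  (lt_le_trans y00 y0z) zM.
have nE : T ^+ 2 * f (M + 1) < F M * n.+1%:R.
  by rewrite [ltRHS]mulrC -ltr_pdivrMr// truncnS_gt.
set e := T / n.+1%:R * f (M + 1) in Fz.
have e0 : 0 < e by rewrite mulr_gt0// divr_gt0.
have Te : T * e < F M.
  by rewrite /e mulrA mulrA mulrAC ltr_pdivrMr// -expr2.
have : T - T * e <= T / (1 + e).
  rewrite ler_pdivlMr; last by lra.
  nra.
lra.
Qed.

End euler_scheme.

(** * Bochner integrals tested by scalar functionals *)

Section integral_complements.
Context d (T : measurableType d) (R : realType).
Variable mu : {measure set T -> \bar R}.

Lemma ae_and (P Q : T -> Prop) :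
  (\forall x \ae mu, P x) -> (\forall x \ae mu, Q x) ->
  \forall x \ae mu, P x /\ Q x.
Proof. exact: filterI. Qed.

(** The integral of a nonnegative function is a supremum over the simple
    functions below it, so monotonicity holds for non-measurable functions
    too. The norms in the definition of a Bochner integral are of this kind. *)
Lemma lower_integral_le (D E : set T) (f g : T -> \bar R) : D `<=` E ->
  (forall x, D x -> 0 <= f x <= g x)%E -> (forall x, E x -> 0 <= g x)%E ->
  (\int[mu]_(x in D) f x <= \int[mu]_(x in E) g x)%E.
Proof.
move=> DE fg g0.
rewrite !ge0_integralE//; last by move=> x /fg/andP[].
apply: ge_ereal_sup => _ [h /= hf <-]; apply: ereal_sup_ubound.
exists h => //= x; apply: (le_trans (hf x)); rewrite /patch.
case: ifPn => [/set_mem Dx|_].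
  by rewrite mem_set ?(andP (fg x Dx)).2//; exact: DE.
by case: ifPn => // /set_mem /g0.
Qed.

Lemma integrable_scaled_indic (D A : set T) (c : R) :
  measurable D -> A `<=` D ->
  (c != 0 -> measurable A /\ (mu A < +oo)%E) ->
  mu.-integrable D (EFin \o (fun x => c * \1_A x)) /\
  (\int[mu]_(x in D) (c * \1_A x)%:E = (c * fine (mu A))%:E)%E.
Proof.
move=> mD AD; have [->|c0 /(_ isT)[mA fA]] := eqVneq c 0.
  move=> _; rewrite mul0r (_ : _ \o _ = cst 0%E); last first.
    by apply/funext => x /=; rewrite mul0r.
  split; first exact: integrable0.
  by rewrite integral0_eq// => x _; rewrite mul0r.
have int1 : (\int[mu]_(x in D) (\1_A x)%:E = mu A)%E.
  by rewrite integral_indic// setIidl.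
have i1 : mu.-integrable D (EFin \o \1_A).
  apply/integrableP; split.
    by apply/measurable_EFinP; exact: measurable_funTS.
  under eq_integral do rewrite /= ger0_norm//.
  by rewrite int1.
split.
  have -> : EFin \o (fun x => c * \1_A x) =
      (fun x => c%:E * (EFin \o \1_A) x)%E.
    by apply/funext => x /=; rewrite EFinM.
  exact: integrableZl.
under eq_integral do rewrite EFinM.
by rewrite integralZl// int1 EFinM fineK// ge0_fin_numE.
Qed.

End integral_complements.

Section weak_bochner_integral.
Context d (T : measurableType d) (R : realType).
Variable mu : {measure set T -> \bar R}.
Context (V : normedModType R).

Definition bounded_scalar (l : {scalar V}) :=
  exists C : R, forall x, `|l x| <= C * `|x|.

Lemma bounded_scalar_cvg (l : {scalar V}) (u : nat -> V) (v : V) :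
  bounded_scalar l -> u n @[n --> \oo] --> v -> l (u n) @[n --> \oo] --> l v.
Proof.
move=> [C lC] /cvgrPdist_lt uv; apply/cvgrPdist_lt => e e0.
have D0 : 0 < `|C| + 1 by rewrite ltr_wpDl.
near=> n; rewrite -raddfB; apply: (le_lt_trans (lC _)).
have : `|v - u n| < e / (`|C| + 1) by near: n; apply: uv; rewrite divr_gt0.
rewrite ltr_pdivlMr// => uve; apply: le_lt_trans uve; rewrite mulrC ler_wpM2l//.
by rewrite (le_trans (ler_norm _))// lerDl.
Unshelve. all: by end_near. Qed.

Lemma step_integral_scalar (D : set T) (s : {fimfun T >-> V}) (l : {scalar V}) :
  measurable D -> integrable_step mu D s ->
  mu.-integrable D (EFin \o (l \o s)) /\
  (\int[mu]_(x in D) (l (s x))%:E = (l (step_integral mu D s))%:E)%E.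
Proof.
move=> mD istep.
pose A v := D `&` s @^-1` [set v].
pose h v x := l v * \1_(A v) x.
pose r : seq V := finmap.enum_fset (fset_set (range s)).
have fin_s : finite_set (range s) by exact: fimfunP.
have lsE x : D x -> l (s x) = \sum_(v <- r) h v x.
  move=> Dx; rewrite (bigD1_seq (s x)) ?finmap.fset_uniq//=; last first.
    by rewrite in_fset_set//; apply: mem_set; exists x.
  rewrite big1 => [|v vs]; rewrite /h indicE.
    by rewrite mem_set ?mulr1 ?addr0.
  by rewrite memNset ?mulr0// => -[_] /= sv; rewrite sv eqxx in vs.
have hi v : mu.-integrable D (EFin \o h v) /\
    (\int[mu]_(x in D) (h v x)%:E = (l v * fine (mu (A v)))%:E)%E.
  apply: integrable_scaled_indic => [//||lv0]; [exact: subIsetl|apply: istep].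
  by apply: contra_neq lv0 => ->; rewrite raddf0.
have hsum : mu.-integrable D (fun x => \sum_(v <- r) (h v x)%:E)%E.
  by apply: integrable_sum => // v _; exact: (hi v).1.
split.
  apply: eq_integrable hsum => // x /set_mem Dx /=.
  by rewrite lsE// sumEFin.
rewrite (eq_integral (fun x => \sum_(v <- r) (h v x)%:E)%E); last first.
  by move=> x /set_mem Dx; rewrite lsE// sumEFin.
rewrite integral_sum//; last by move=> v; exact: (hi v).1.
under eq_bigr do rewrite (hi _).2.
rewrite sumEFin /step_integral fsbig_finite//= (raddf_sum l).
by congr (_%:E); apply: eq_bigr => v _; rewrite /= scalarZ mulrC.
Qed.

(** Testing with bounded functionals turns Bochner integrals into Lebesgue
    integrals, for which the domain can be cut. The null set is where the step
    functions fail to converge: outside of it [l \o g] is measurable. *)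
Lemma bochner_integral_scalar (D : set T) (g : T -> V) (v : V)
    (l : {scalar V}) :
  measurable D -> bounded_scalar l -> is_bochner_integral mu D g v ->
  exists N, [/\ measurable N, mu N = 0%E,
    mu.-integrable (D `\` N) (EFin \o (l \o g)) &
    \int[mu]_(x in D `\` N) l (g x) = l v].
Proof.
move=> mD bl [s [istep [N [mN N0 subN]] s_g] sv].
exists N; pose B := D `\` N.
have mB : measurable B by exact: measurableD.
have BD : B `<=` D by exact: subDsetl.
have cvg_ls x : B x -> l (s n x) @[n --> \oo] --> l (g x).
  move=> [Dx Nx]; apply: bounded_scalar_cvg => //.
  by apply: contra_notP Nx => sx; apply: subN => /= /(_ Dx).
have ls n := step_integral_scalar l mD (istep n).
have iB n : mu.-integrable B (EFin \o (l \o s n)).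
  exact: (integrableS _ _ BD (ls n).1).
have IB n : \int[mu]_(x in B) l (s n x) = l (step_integral mu D (s n)).
  rewrite /Rintegral -(negligible_integral _ _ (ls n).1)//.
  by rewrite (ls n).2.
have mlg : measurable_fun B (l \o g).
  apply: (@measurable_fun_cvg _ _ _ _ (fun n => l \o s n)) => // n.
  exact/measurable_EFinP/measurable_int/(iB n).
have [C lC] := bl.
pose C1 := `|C| + 1.
have C10 : 0 < C1 by rewrite ltr_wpDl.
have lC1 x : `|l x| <= C1 * `|x|.
  by rewrite (le_trans (lC x))// ler_wpM2r// (le_trans (ler_norm _))// lerDl.
have mdiff n : measurable_fun B (fun x => l (g x) - l (s n x)).
  apply: measurable_funB => //.
  exact/measurable_EFinP/measurable_int/(iB n).
have small e : 0 < e -> \forall n \near \oo,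
    (\int[mu]_(x in B) (`|l (g x) - l (s n x)|)%:E < e%:E)%E.
  move=> e0.
  have eC : (0 < (e / C1)%:E)%E by rewrite lte_fin divr_gt0.
  have near_s : \forall n \near \oo,
      (\int[mu]_(x in D) `|g x - s n x|%:E < (e / C1)%:E)%E.
    exact: (s_g _ (open_ereal_lt' eC)).
  apply: filterS near_s => n In.
  rewrite (eq_integral
    (fun x => C1%:E * (`|l (g x) - l (s n x)| / C1)%:E)%E); last first.
    by move=> x _; rewrite -EFinM mulrC divfK// gt_eqF.
  rewrite ge0_integralZl//; last by rewrite lee_fin ltW.
  - rewrite muleC -lte_pdivlMr//; apply: le_lt_trans In.
    apply: lower_integral_le => // x _.
    rewrite !lee_fin divr_ge0 ?(ltW C10)//= ler_pdivrMr// mulrC -raddfB.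
    exact: lC1.
  - apply/measurable_EFinP; apply: measurable_funM => //.
    exact: measurableT_comp.
  - by move=> x _; rewrite lee_fin divr_ge0// ltW.
have idiff n : (\int[mu]_(x in B) (`|l (g x) - l (s n x)|)%:E < +oo)%E ->
    mu.-integrable B (EFin \o (fun x => l (g x) - l (s n x))).
  by move=> fin; apply/integrableP; split; first exact/measurable_EFinP.
have ilg : mu.-integrable B (EFin \o (l \o g)).
  have [n _ /(_ n (leqnn n)) /= Hn] := small 1 ltr01.
  have := integrableD mB (idiff n (lt_trans Hn (ltry _))) (iB n).
  by apply: eq_integrable => // x _ /=; rewrite -EFinD subrK.
split => //.
apply: (@cvg_unique _ _ (l (step_integral mu D (s n)) @[n --> \oo])) => //;
  last exact: bounded_scalar_cvg.
apply/cvgrPdist_lt => e e0; have := small e e0; apply: filterS => n Hn.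
rewrite -IB -RintegralB//; last exact: iB.
have id := idiff n (lt_trans Hn (ltry _)).
apply: (le_lt_trans (le_normr_Rintegral mB id)).
rewrite -lte_fin /Rintegral fineK//.
apply: integrable_fin_num => //.
exact: (integrable_norm id).
Qed.

End weak_bochner_integral.

(** * Integration over finite-measure sets as a functional on L^p *)

Section Lspace_facts.
Context d (X : measurableType d) (R : realType).
Variables (m : {measure set X -> \bar R}) (p : R) (p1 : (1 <= p%:E)%E).
Local Notation Lp := (LspaceType m p1).

Let p_gt0 : 0 < p.
Proof. by rewrite (lt_le_trans ltr01)// -lee_fin. Qed.

Lemma Lrepr_measurable (u : Lp) : measurable_fun setT (Lrepr u).
Proof. exact: (@measurable_funPT _ _ _ _ (Lrepr u)). Qed.

Lemma Lrepr0 : \forall x \ae m, Lrepr (0 : Lp) x = 0.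
Proof. exact: (LclassE 0). Qed.

Lemma LreprD (u v : Lp) :
  \forall x \ae m, Lrepr (u + v) x = Lrepr u x + Lrepr v x.
Proof. exact: (LclassE (Lrepr u + Lrepr v)). Qed.

Lemma LreprZ c (u : Lp) : \forall x \ae m, Lrepr (c *: u) x = c * Lrepr u x.
Proof. exact: (LclassE (c *: Lrepr u)). Qed.

Lemma LreprN (u : Lp) : \forall x \ae m, Lrepr (- u) x = - Lrepr u x.
Proof. exact: (LclassE (- Lrepr u)). Qed.

Lemma LreprB (u v : Lp) :
  \forall x \ae m, Lrepr (u - v) x = Lrepr u x - Lrepr v x.
Proof. by apply: filterS2 (LreprD u (- v)) (LreprN v) => x -> ->. Qed.

Lemma Lspace_norm_powR (u : Lp) :
  (\int[m]_x (`|Lrepr u x| `^ p)%:E = (`|u| `^ p)%:E)%E.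
Proof.
have pn0 : p != 0 by rewrite gt_eqF.
rewrite Lspace_normrE -poweR_EFin finite_norm_fine powR_Lnorm//.
Qed.

Lemma Lspace_powR_integrable (u : Lp) :
  m.-integrable setT (fun x => (`|Lrepr u x| `^ p)%:E).
Proof. by apply: Lfun_integrable (LfunP (Lrepr u)); rewrite -lee_fin. Qed.

Lemma Lspace_dominated (u : Lp) (g : X -> R) : measurable_fun setT g ->
  (forall x, `|g x| <= `|Lrepr u x|) ->
  exists v : Lp, \forall x \ae m, Lrepr v x = g x.
Proof.
move=> mg gu.
have gP : g \in Lfun m p%:E.
  apply/andP; split; apply/mem_set => //=.
  rewrite /finite_norm unlock /=; apply: poweR_lty.
  have /integrableP[_] := Lspace_powR_integrable u.
  apply: le_lt_trans; apply: ge0_le_integral => //.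
  - apply/measurable_EFinP; apply: (measurableT_comp (measurable_powR _)) => //.
    exact: measurableT_comp.
  - apply: measurableT_comp => //.
    exact/(measurable_int m)/Lspace_powR_integrable.
  - move=> x _ /=; rewrite lee_fin [leRHS]ger0_norm ?powR_ge0//.
    by rewrite ge0_ler_powR ?nnegrE// ltW.
exists (Lclass (Lfun_Sub p1 gP)); exact: LclassE.
Qed.

Lemma norm_le_1powR (y : R) : `|y| <= 1 + `|y| `^ p.
Proof.
have [y1|/ltW y1] := leP `|y| 1.
  by rewrite (le_trans y1)// lerDl powR_ge0.
rewrite (@le_trans _ _ (`|y| `^ p))// ?lerDr//.
by rewrite -{1}(powRr1 (normr_ge0 y)) ler_powR// -lee_fin.
Qed.

Section integral_over_finite_set.
Variable E : set X.
Hypotheses (mE : measurable E) (fE : (m E < +oo)%E).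

Let integrable_1 : m.-integrable E (EFin \o cst 1).
Proof.
apply: measurable_bounded_integrable => //.
by exists 1; split; [exact: num_real|move=> M M1 x _; rewrite /= normr1 ltW].
Qed.

Let integrable_1powR (u : Lp) :
  m.-integrable E (EFin \o (fun x => 1 + `|Lrepr u x| `^ p)).
Proof.
have iu := integrableS _ mE (@subsetT _ E) (Lspace_powR_integrable u).
exact: (integrableD mE integrable_1 (iu measurableT)).
Qed.

Lemma Lspace_integrable (u : Lp) : m.-integrable E (EFin \o Lrepr u).
Proof.
apply: le_integrable (integrable_1powR u) => //.
  apply/measurable_EFinP; apply: measurable_funTS; exact: Lrepr_measurable.
move=> x _ /=; rewrite lee_fin [leRHS]ger0_norm ?addr_ge0 ?powR_ge0//.
exact: norm_le_1powR.
Qed.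

Definition set_integral (u : Lp) : R := \int[m]_(x in E) Lrepr u x.

Lemma set_integral_ae (u : Lp) (g : X -> R) : measurable_fun E g ->
  (\forall x \ae m, Lrepr u x = g x) -> set_integral u = \int[m]_(x in E) g x.
Proof.
move=> mg ug; rewrite /set_integral /Rintegral; congr fine.
apply: ae_eq_integral => //; try exact/measurable_EFinP.
  apply/measurable_EFinP/measurable_funTS; exact: Lrepr_measurable.
by apply: filterS ug => x /= -> _.
Qed.

Let mrepr (u : Lp) : measurable_fun E (Lrepr u).
Proof. apply: measurable_funTS; exact: Lrepr_measurable. Qed.

Lemma set_integral_scalar : scalar set_integral.
Proof.
move=> c u v.
have -> : set_integral (c *: u + v) =
    \int[m]_(x in E) (c * Lrepr u x + Lrepr v x).
  apply: set_integral_ae.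
    apply: measurable_funD => //; exact: measurable_funM.
  by apply: filterS2 (LreprD (c *: u) v) (LreprZ c u) => x -> ->.
rewrite RintegralD//; first last.
- exact: Lspace_integrable.
- exact: (integrableZl mE c (Lspace_integrable u)).
by rewrite RintegralZl//; exact: Lspace_integrable.
Qed.

HB.instance Definition _ :=
  GRing.isLinear.Build R Lp R *%R set_integral set_integral_scalar.

Definition set_functional : {scalar Lp} := set_integral.

Lemma set_integralD (u v : Lp) :
  set_integral (u + v) = set_integral u + set_integral v.
Proof. exact: (raddfD set_functional). Qed.

Lemma set_integralB (u v : Lp) :
  set_integral (u - v) = set_integral u - set_integral v.
Proof. exact: (raddfB set_functional). Qed.

Lemma set_integralZ c (u : Lp) : set_integral (c *: u) = c * set_integral u.
Proof. exact: (scalarZ set_functional). Qed.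

(** On the unit sphere [|u| <= 1 + |u|^p] bounds the integral by [m E + 1]. *)
Lemma set_functional_bounded : bounded_scalar set_functional.
Proof.
exists (fine (m E) + 1) => u; rewrite /set_functional.
have [->|u0] := eqVneq u 0; first by rewrite raddf0 !normr0 mulr0.
have nu0 : 0 < `|u| by rewrite normr_gt0.
pose w := `|u|^-1 *: u.
have w1 : `|w| = 1 by rewrite normrZ normfV normr_id mulVf// gt_eqF.
have uE : u = `|u| *: w by rewrite scalerA divff ?gt_eqF// scale1r.
rewrite {1}uE scalarZ normrM normr_id mulrC ler_pM2r//.
apply: (le_trans (le_normr_Rintegral mE (Lspace_integrable w))).
apply: (@le_trans _ _ (\int[m]_(x in E) (1 + `|Lrepr w x| `^ p))).
  apply: le_Rintegral => //.
  - exact: (integrable_norm (Lspace_integrable w)).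
  - by move=> x _; exact: norm_le_1powR.
have ip : m.-integrable E (EFin \o (fun x => `|Lrepr w x| `^ p)).
  exact: (integrableS _ _ (@subsetT _ E) (Lspace_powR_integrable w)).
rewrite RintegralD// Rintegral_cst// mul1r lerD2l.
rewrite -lee_fin /Rintegral fineK; last exact: integrable_fin_num.
rewrite -[leRHS](_ : (\int[m]_x (`|Lrepr w x| `^ p)%:E = 1%:E)%E); last first.
  by rewrite Lspace_norm_powR w1 powR1.
apply: ge0_subset_integral => //.
  exact/(measurable_int m)/Lspace_powR_integrable.
Qed.

Lemma set_integral_ae_le (u v : Lp) (c b : R) :
  (\forall x \ae m, c * Lrepr u x + b <= Lrepr v x) ->
  c * set_integral u + b * fine (m E) <= set_integral v.
Proof.
move=> [N [mN N0 subN]]; pose B := E `\` N.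
have mB : measurable B by exact: measurableD.
have EN0 : m (E `&` N) = 0%E.
  apply/eqP; rewrite eq_le measure_ge0 andbT -N0.
  apply: (le_measure m (mem_set (measurableI _ _ mE mN)) (mem_set mN)).
  exact: subIsetr.
have mBE : m E = m B.
  by rewrite (measureD mE mN fE); move: EN0; rewrite /= => ->; rewrite sube0.
have iB (w : Lp) : m.-integrable B (EFin \o Lrepr w).
  by apply: (integrableS mE mB) (Lspace_integrable w); exact: subDsetl.
have IB (w : Lp) : set_integral w = \int[m]_(x in B) Lrepr w x.
  rewrite /set_integral /Rintegral; congr fine.
  exact: (negligible_integral mN mE (Lspace_integrable w) N0).
have ib : m.-integrable B (EFin \o cst b).
  apply: measurable_bounded_integrable => //; first by rewrite -mBE.
  by exists `|b|; split; [exact: num_real|move=> M bM x _; exact: ltW].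
have icu : m.-integrable B (EFin \o (fun x => c * Lrepr u x)).
  exact: (integrableZl mB c (iB u)).
rewrite !IB -RintegralZl// mBE -Rintegral_cst// -RintegralD//.
apply: le_Rintegral => //; first exact: (integrableD mB icu ib).
by move=> x [_ Nx]; apply: contra_notT Nx => ux; apply: subN => /=; exact/negP.
Qed.

End integral_over_finite_set.

Lemma Lspace_nneg_truncation (u : Lp) (c : R) : 0 <= c -> Lspace_nneg u ->
  exists v : Lp, \forall x \ae m, Lrepr v x = Num.min (Lrepr u x) c.
Proof.
move=> c0 u0.
have [|x|v vE] := @Lspace_dominated u (fun x => Num.min (Num.max (Lrepr u x) 0) c).
- by apply: measurable_minr => //; exact: measurable_maxr.
- rewrite ger0_norm; last by rewrite le_min c0 le_max lexx orbT.
  by rewrite ge_min ge_max normr_ge0 ler_norm.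
- exists v; apply: filterS2 vE u0 => x -> u0.
  by rewrite (max_idPl u0).
Qed.

(** Dominated convergence, with the dominating function [|u|^p]. *)
Lemma Lspace_truncation_cvg (u : Lp) (v : nat -> Lp) : Lspace_nneg u ->
  (forall n, \forall x \ae m, Lrepr (v n) x = Num.min (Lrepr u x) n%:R) ->
  v n @[n --> \oo] --> u.
Proof.
move=> u0 vE.
pose h n x := `|Lrepr u x - Num.min (Lrepr u x) n%:R| `^ p.
have mh n : measurable_fun setT (h n).
  apply: (measurableT_comp (measurable_powR _)) => //.
  apply: measurableT_comp => //; apply: measurable_funB.
    exact: Lrepr_measurable.
  by apply: measurable_minr => //; exact: Lrepr_measurable.
have hE n : (\int[m]_x (h n x)%:E = (`|u - v n| `^ p)%:E)%E.
  rewrite -Lspace_norm_powR; apply: ae_eq_integral => //.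
  - exact/measurable_EFinP.
  - exact/(measurable_int m)/Lspace_powR_integrable.
  - by apply: filterS2 (LreprB u (v n)) (vE n) => x /= -> -> _.
have cvgh : \forall x \ae m, setT x -> (h n x)%:E @[n --> \oo] --> 0%E.
  apply: filterS u0 => x u0 _; apply: cvg_near_cst.
  exists (Num.truncn (Lrepr u x)).+1 => // n /= un.
  have /min_idPl minE : Lrepr u x <= n%:R.
    by rewrite (le_trans (ltW (truncnS_gt _)))// ler_nat.
  by rewrite /h minE subrr normr0 powR0// gt_eqF.
have dom : \forall x \ae m, forall n, setT x ->
    (`|(h n x)%:E| <= (`|Lrepr u x| `^ p)%:E)%E.
  apply: filterS u0 => x u0 n _.
  rewrite lee_fin ger0_norm ?powR_ge0// ge0_ler_powR ?nnegrE// ?(ltW p_gt0)//.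
  have n0 : 0 <= n%:R :> R by exact: ler0n.
  rewrite /Num.min; case: ltP => un; first by rewrite subrr normr0.
  by rewrite !ger0_norm ?subr_ge0// gerBl.
have [_ _] := dominated_convergence measurableT
  (fun n => (measurable_EFinP _ _).2 (mh n)) (@measurable_cst _ _ _ _ setT 0%E)
  cvgh (Lspace_powR_integrable u) dom.
rewrite integral0 => lim0.
apply/cvgrPdist_lt => e e0.
have ep : (0 < (e `^ p)%:E)%E by rewrite lte_fin powR_gt0.
have near_h : \forall n \near \oo, (\int[m]_x (h n x)%:E < (e `^ p)%:E)%E.
  exact: (lim0 _ (open_ereal_lt' ep)).
apply: filterS near_h => n; rewrite hE lte_fin => lt_p.
rewrite ltNge; apply: contraTN lt_p => le_e; rewrite -leNgt.
by rewrite ge0_ler_powR ?nnegrE ?(ltW p_gt0) ?(ltW e0).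
Qed.

End Lspace_facts.

(** * Order in L^p and sub-Markovian operators *)

Section sigma_finite_order.
Context d (X : measurableType d) (R : realType).
Variables (m : {sigma_finite_measure set X -> \bar R}).
Variables (p : R) (p1 : (1 <= p%:E)%E).
Local Notation Lp := (LspaceType m p1).

(** By sigma-finiteness the set where the inequality fails is a countable union
    of sets of finite measure, and on each of them the integral of a negative
    function would be nonnegative. *)
Lemma ae_ge_set_integral (u : Lp) (b : R) :
  (forall E, measurable E -> (m E < +oo)%E ->
     0 <= set_integral E u + b * fine (m E)) ->
  \forall x \ae m, 0 <= Lrepr u x + b.
Proof.
move=> intE; have [F FU mF] := sigma_finiteT m.
pose h x := Lrepr u x + b.
have mh : measurable_fun setT h.
  by apply: measurable_funD => //; exact: Lrepr_measurable.
have mneg : measurable [set x | h x < 0].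
  rewrite -[X in measurable X]setTI (_ : [set x | _] = h @^-1` `]-oo, 0[).
    by apply: mh => //; exact: measurable_itv.
  by apply/seteqP; split => x /=; rewrite in_itv.
have neg n : \forall x \ae m, ~ (F n `&` [set x | h x < 0]) x.
  have [mFn fFn] := mF n; set B := F n `&` _.
  have mB : measurable B by exact: measurableI.
  have fB : (m B < +oo)%E.
    apply: le_lt_trans fFn.
    exact: (le_measure m (mem_set mB) (mem_set mFn) (@subIsetl _ _ _)).
  have ib : m.-integrable B (EFin \o cst b).
    apply: measurable_bounded_integrable => //.
    by exists `|b|; split; [exact: num_real|move=> M bM x _; exact: ltW].
  have iu := Lspace_integrable mB fB u.
  have ih : m.-integrable B (EFin \o h) by exact: (integrableD mB iu ib).
  have := intE B mB fB.
  rewrite -Rintegral_cst// -RintegralD// => h0.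
  have mhB : measurable_fun B (EFin \o h) by exact: (measurable_int m ih).
  have : (\int[m]_(x in B) `|(EFin \o h) x| = 0)%E.
    apply/eqP; rewrite eq_le; apply/andP; split; last exact: integral_ge0.
    rewrite (eq_integral (fun x => - (h x)%:E)%E); last first.
      move=> x /set_mem [_ hx] /=.
      by rewrite ler0_norm// ltW.
    rewrite integralN//; last exact: integrable_add_def.
    rewrite leeNl oppe0 -(fineK (integrable_fin_num mB ih)) lee_fin.
    exact: h0.
  move=> /(ae_eq_integral_abs _ mB mhB).1.
  apply: filterS => x /= hB Bx; have [hx0] := hB Bx.
  by move: Bx => [_ /=]; rewrite hx0 ltxx.
apply: filterS (ae_foralln neg) => x nx.
rewrite leNgt; apply/negP => hx.
have : (\bigcup_i F i) x by rewrite -FU.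
by move=> [n _ Fx]; exact: (nx n).
Qed.

Lemma nneg_set_integral (u : Lp) :
  (forall E, measurable E -> (m E < +oo)%E -> 0 <= set_integral E u) ->
  Lspace_nneg u.
Proof.
move=> intE.
have : \forall x \ae m, 0 <= Lrepr u x + 0.
  by apply: ae_ge_set_integral => E mE fE; rewrite mul0r addr0; exact: intE.
by apply: filterS => x; rewrite addr0.
Qed.

Lemma set_integral_nneg (u : Lp) E : measurable E -> (m E < +oo)%E ->
  Lspace_nneg u -> 0 <= set_integral E u.
Proof.
move=> mE fE u0.
have := @set_integral_ae_le _ _ _ _ _ _ _ mE fE u u 0 0.
rewrite !mul0r addr0; apply; apply: filterS u0 => x.
by rewrite mul0r addr0.
Qed.

End sigma_finite_order.

Section sub_markovian_operators.
Context d (X : measurableType d) (R : realType).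
Variables (m : {sigma_finite_measure set X -> \bar R}).
Variables (p : R) (p1 : (1 <= p%:E)%E).
Local Notation Lp := (LspaceType m p1).
Variable A : {linear Lp -> Lp}.
Hypothesis A_bounded : exists M : R, forall x, `|A x| <= M * `|x|.
Hypothesis A_markov : forall u : Lp, (\forall x \ae m, 0 <= Lrepr u x <= 1) ->
  \forall x \ae m, 0 <= Lrepr (A u) x <= 1.

Lemma bounded_scalar_comp (l : {scalar Lp}) : bounded_scalar l ->
  bounded_scalar (l \o A : {scalar Lp}).
Proof.
move=> [C lC]; have [M AM] := A_bounded; exists (`|C| * M) => x /=.
rewrite (le_trans (lC _))// -mulrA.
rewrite (@le_trans _ _ (`|C| * `|A x|))//.
  by rewrite ler_wpM2r// ler_norm.
by rewrite ler_wpM2l.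
Qed.

Lemma sub_markovian_scaled (u : Lp) (c : R) : 0 < c ->
  (\forall x \ae m, 0 <= Lrepr u x <= c) ->
  \forall x \ae m, 0 <= Lrepr (A u) x <= c.
Proof.
move=> c0 uc.
have -> : u = c *: (c^-1 *: u) by rewrite scalerA divff ?gt_eqF// scale1r.
rewrite linearZ /=.
have : \forall x \ae m, 0 <= Lrepr (A (c^-1 *: u)) x <= 1.
  apply: A_markov; apply: filterS2 uc (LreprZ c^-1 u) => x /andP[u0 uc] ->.
  by rewrite mulr_ge0 ?invr_ge0 ?(ltW c0)// mulrC ler_pdivrMr// mul1r.
apply: filterS2 (LreprZ c (A (c^-1 *: u))) => x -> /andP[Au0 Au1].
by rewrite mulr_ge0 ?(ltW c0)//= -[leRHS]mulr1 ler_pM2l.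
Qed.

(** The sub-Markovian property only speaks of bounded functions: it gives
    positivity for the truncations [min u n], which converge to [u] in norm, and
    continuity of [A] carries it to the limit. *)
Lemma sub_markovian_positive (u : Lp) : Lspace_nneg u -> Lspace_nneg (A u).
Proof.
move=> u0.
have /choice[v vE] : forall n, exists v : Lp,
    \forall x \ae m, Lrepr v x = Num.min (Lrepr u x) n%:R.
  by move=> n; exact: Lspace_nneg_truncation.
have vu := Lspace_truncation_cvg u0 vE.
have Av0 n : Lspace_nneg (A (v n)).
  have : \forall x \ae m, 0 <= Lrepr (A (v n)) x <= n.+1%:R.
    apply: sub_markovian_scaled => //; apply: filterS2 u0 (vE n) => x u0 ->.
    rewrite le_min u0 ler0n /= ge_min; apply/orP; right.
    by rewrite ler_nat.
  by apply: filterS => x /andP[].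
apply: nneg_set_integral => E mE fE.
have lim := bounded_scalar_cvg
  (bounded_scalar_comp (set_functional_bounded p1 mE fE)) vu.
change (0 <= (set_functional p1 mE fE \o A) u).
rewrite -(cvg_lim (@Rhausdorff R) lim).
apply: limr_ge; first by apply: cvgP lim.
by apply: nearW => n; exact: set_integral_nneg.
Qed.

Lemma sub_markovian_le (u : Lp) (c : R) : 0 <= c ->
  (\forall x \ae m, 0 <= Lrepr u x <= c) ->
  \forall x \ae m, Lrepr (A u) x <= c.
Proof.
rewrite le_eqVlt => /predU1P[<-|c0] uc; last first.
  by apply: filterS (sub_markovian_scaled c0 uc) => x /andP[].
have -> : u = 0.
  apply: Lspace_aeP; apply: filterS2 uc (Lrepr0 m p1) => x u0 ->.
  by apply/eqP; rewrite eq_le andbC.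
by rewrite raddf0; apply: filterS (Lrepr0 m p1) => x ->.
Qed.

(** The constant [be] need not belong to [L^p], but [min (al u) be] does, and it
    is mapped below [be]. Since [w] dominates
    [max (al u - be) 0 = al u - min (al u) be], positivity concludes. *)
Lemma sub_markovian_affine (al be : R) (u w : Lp) :
  0 <= al -> 0 <= be -> Lspace_nneg u ->
  (\forall x \ae m, 0 <= Lrepr w x) ->
  (\forall x \ae m, al * Lrepr u x - be <= Lrepr w x) ->
  \forall x \ae m, al * Lrepr (A u) x - be <= Lrepr (A w) x.
Proof.
move=> al0 be0 u0 w0 wu.
have alu0 : Lspace_nneg (al *: u).
  by apply: filterS2 u0 (LreprZ al u) => x ux ->; rewrite mulr_ge0.
have [chi chiE] := Lspace_nneg_truncation be0 alu0.
have pos : Lspace_nneg (w - al *: u + chi).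
  have sumE := ae_and
    (LreprD (w - al *: u) chi) (LreprB w (al *: u)).
  have h1 := ae_and w0 wu; have h2 := ae_and chiE (LreprZ al u).
  apply: filterS3 h1 h2 sumE => x [w0x wux] [chix alux] [-> ->].
  rewrite chix alux.
  by rewrite /Num.min; case: ltP; lra.
have chi_le : \forall x \ae m, Lrepr (A chi) x <= be.
  apply: sub_markovian_le => //; apply: filterS2 chiE alu0 => x -> alux.
  by rewrite le_min alux be0 ge_min lexx orbT.
have := sub_markovian_positive pos.
have AE := ae_and
  (LreprD (A w - al *: A u) (A chi)) (LreprB (A w) (al *: A u)).
rewrite linearD linearB linearZ /= => Apos.
apply: filterS3 (ae_and AE (LreprZ al (A u)))
  chi_le Apos => x [[-> ->] ->] h1 h2.
change (al * Lrepr (A u) x - be <= Lrepr (A w) x); lra.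
Qed.

End sub_markovian_operators.

(** * Increments of Bochner integrals in time *)

Section bochner_on_intervals.
Context (R : realType) (V : normedModType R).
Local Notation leb :=
  (lebesgue_measure : {measure set (measurableTypeR R) -> \bar R}).

Lemma bochner_integral_set0 (g : measurableTypeR R -> V) (v : V) :
  is_bochner_integral leb set0 g v -> v = 0.
Proof.
move=> [s _ sv]; apply: (cvg_unique _ sv); first exact: norm_hausdorff.
rewrite (_ : (fun n => _) = fun=> 0); first exact: cvg_cst.
apply/funext => n; rewrite /step_integral fsbig1// => w _.
by rewrite set0I measure0 scale0r.
Qed.

(** The two integrals are limits along unrelated step functions; after testing,
    both are Lebesgue integrals of one function, and their difference is its
    integral over the remaining interval. *)
Lemma bochner_increment (l1 l2 : {scalar V}) (g1 g2 : measurableTypeR R -> V)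
    (v1 v2 : V) (t1 t2 c : R) : bounded_scalar l1 -> bounded_scalar l2 ->
  0 <= t1 -> t1 <= t2 ->
  is_bochner_integral leb `]0, t1]%classic g1 v1 ->
  is_bochner_integral leb `]0, t2]%classic g2 v2 ->
  (forall s, 0 < s -> s <= t1 -> l1 (g1 s) = l2 (g2 s)) ->
  (forall s, t1 < s -> s <= t2 -> c <= l2 (g2 s)) ->
  (t2 - t1) * c <= l2 v2 - l1 v1.
Proof.
move=> bl1 bl2 t10 t12 int1 int2 g12 cg.
pose D1 : set (measurableTypeR R) := `]0, t1]%classic.
pose D2 : set (measurableTypeR R) := `]0, t2]%classic.
pose D3 : set (measurableTypeR R) := `]t1, t2]%classic.
have mD1 : measurable D1 by exact: measurable_itv.
have mD2 : measurable D2 by exact: measurable_itv.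
have mD3 : measurable D3 by exact: measurable_itv.
have [N1 [mN1 N10 i1 <-]] := bochner_integral_scalar mD1 bl1 int1.
have [N2 [mN2 N20 i2 <-]] := bochner_integral_scalar mD2 bl2 int2.
have D2E : D2 = D1 `|` D3.
  apply/seteqP; split => s; rewrite /D1 /D2 /D3 /= !in_itv /=.
    by move=> /andP[s0 st]; have [s1|s1] := leP s t1; [left|right]; rewrite ?s0 ?s1.
  by move=> [|] /andP[a b]; apply/andP; split; lra.
pose N := N1 `|` N2.
have mN : measurable N by exact: measurableU.
have N0 : leb N = 0%E by rewrite measureU0.
have IN1 : \int[leb]_(s in D1 `\` N1) l1 (g1 s) =
    \int[leb]_(s in D1 `\` N) l2 (g2 s).
  rewrite /Rintegral (negligible_integral mN2 _ i1 N20); last exact: measurableD.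
  rewrite setDDl -/N; congr fine; apply: eq_integral => s /set_mem [].
  by rewrite /D1 /= in_itv /= => /andP[s0 s1] _; rewrite /= g12.
have IN2 : \int[leb]_(s in D2 `\` N2) l2 (g2 s) =
    \int[leb]_(s in D2 `\` N) l2 (g2 s).
  rewrite /Rintegral (negligible_integral mN1 _ i2 N10); last exact: measurableD.
  by rewrite setDDl setUC.
have mDN D : measurable D -> measurable (D `\` N) by move=> mD; exact: measurableD.
have iD2 : leb.-integrable (D2 `\` N) (EFin \o (l2 \o g2)).
  apply: (integrableS _ _ _ i2); [exact: measurableD|exact: mDN|].
  by apply: setDS; exact: subsetUr.
rewrite IN1 IN2 D2E setDUl.
rewrite Rintegral_setU; first last.
- apply/disj_setPS => s [[]]; rewrite /D1 /D3 /= !in_itv /= => /andP[_ s1] _.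
  by move=> [/andP[]]; rewrite ltNge s1.
- by rewrite -setDUl -D2E.
- exact: mDN.
- exact: mDN.
rewrite [leRHS]addrAC subrr add0r.
have ic : leb.-integrable D3 (EFin \o cst c).
  apply: measurable_bounded_integrable => //=.
    by rewrite lebesgue_measure_itv /=; case: ifP; rewrite // -EFinB ltry.
  by exists `|c|; split; [exact: num_real|move=> M cM s _; exact: ltW].
have -> : (t2 - t1) * c = \int[leb]_(s in D3 `\` N) c.
  have -> : \int[leb]_(s in D3 `\` N) c = \int[leb]_(s in D3) c.
    by rewrite /Rintegral (negligible_integral mN mD3 ic N0).
  rewrite Rintegral_cst// [RHS]mulrC; congr (_ * _).
  have muE : leb D3 = (t2 - t1)%:E.
    apply: (etrans (lebesgue_measure_itv `]t1, t2])); rewrite /= lte_fin.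
    by case: ltgtP t12 => // ->; rewrite subrr.
  exact: (congr1 fine (esym muE)).
apply: le_Rintegral.
- exact: mDN.
- by apply: (integrableS _ _ _ ic); [exact: mD3|exact: mDN|exact: subDsetl].
- apply: (integrableS _ _ _ iD2); [exact: mDN|exact: mDN|].
  by rewrite D2E; apply: setSD; exact: subsetUr.
- by move=> s [+ _]; rewrite /D3 /= in_itv /= => /andP[ts st]; exact: cg.
Qed.

End bochner_on_intervals.

(** * The transported solution *)

Section transported_solution.
Context d (X : measurableType d) (R : realType).
Variables (m : {sigma_finite_measure set X -> \bar R}).
Variables (p : R) (p1 : (1 <= p%:E)%E).
Local Notation Lp := (LspaceType m p1).
Variable S : R -> {linear Lp -> Lp}.
Hypothesis hS : strongly_continuous_semigroup S.
Hypothesis hSM : sub_markovian S.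
Variable f : R -> R.
Hypothesis f_convex : convex_function (`[0, +oo[%classic : set R) f.
Hypothesis f0 : f 0 = 0.
Hypothesis f_gt0 : forall s : R, 0 < s -> 0 < f s.
Variables (a : Lp) (T : R) (I : set R) (u : R -> Lp).
Hypothesis u_mild : mild_solution S f a I u.
Hypothesis I_T : forall t, 0 <= t -> t <= T -> I t.

(** Evaluating all states at the final time [T] makes Duhamel's formula a plain
    integral in time, with an integrand that does not depend on [t]. *)
Definition transported (t : R) : Lp := S (T - t) (u t).

Lemma semigroup_markov t : 0 <= t -> forall phi : Lp,
  (\forall x \ae m, 0 <= Lrepr phi x <= 1) ->
  \forall x \ae m, 0 <= Lrepr (S t phi) x <= 1.
Proof.
rewrite le_eqVlt => /predU1P[<- phi phi01|]; last exact: hSM.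
by have [_ -> _ _] := hS.
Qed.

Lemma semigroup_bounded t : 0 <= t ->
  exists M : R, forall x, `|S t x| <= M * `|x|.
Proof. by have [bS _ _ _] := hS; exact: bS. Qed.

Lemma semigroup_split r s t (phi : Lp) : r <= s -> s <= t ->
  S (t - s) (S (s - r) phi) = S (t - r) phi.
Proof.
move=> rs st; have [_ _ SD _] := hS.
by rewrite -SD ?subr_ge0//; congr (S _ phi); lra.
Qed.

Lemma superpositionP t : 0 < t -> t <= T ->
  Lspace_nneg (u t) /\ is_superposition f (u t) (superposition f (u t)).
Proof.
move=> t0 tT; have [_ domu _ _] := u_mild.
have [nn ex] := domu t (I_T (ltW t0) tT) (lt0r_neq0 t0).
by split=> //; exact: (xgetPex 0 ex).
Qed.

(** Jensen's inequality for the sub-Markovian operator [S (T - t)], one affine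
    minorant of [f] at a time. *)
Lemma transported_reaction_ge (al be t : R) : 0 <= al -> 0 <= be ->
  (forall y, 0 <= y -> al * y - be <= f y) -> 0 < t -> t <= T ->
  \forall x \ae m, al * Lrepr (transported t) x - be <=
    Lrepr (S (T - t) (superposition f (u t))) x.
Proof.
move=> al0 be0 minor t0 tT.
have Tt : 0 <= T - t by rewrite subr_ge0.
have [ut0 fut] := superpositionP t0 tT.
apply: sub_markovian_affine => //.
- exact: semigroup_bounded.
- exact: semigroup_markov.
- by apply: filterS2 ut0 fut => x ux ->; exact: (convex_ge0 f0 f_gt0).
- by apply: filterS2 ut0 fut => x ux ->; exact: minor.
Qed.

Lemma transported_increment E t1 t2 c : measurable E -> (m E < +oo)%E ->
  0 <= t1 -> t1 <= t2 -> t2 <= T ->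
  (forall s, t1 < s -> s <= t2 ->
     c <= set_integral E (S (T - s) (superposition f (u s)))) ->
  (t2 - t1) * c <=
    set_integral E (transported t2) - set_integral E (transported t1).
Proof.
move=> mE fE t10 t12 t2T cE.
have t1T := le_trans t12 t2T; have t20 := le_trans t10 t12.
have [_ _ _ umild] := u_mild.
have [v1 int1 u1] := umild t1 (I_T t10 t1T).
have [v2 int2 u2] := umild t2 (I_T t20 t2T).
pose l t : {scalar Lp} := set_functional p1 mE fE \o S (T - t).
have transE t v : 0 <= t -> t <= T -> u t = S t a + v ->
    set_integral E (transported t) = set_integral E (S T a) + l t v.
  move=> t0 tT uE; rewrite /transported uE linearD.
  have := semigroup_split a t0 tT; rewrite !subr0 => ->.
  exact: (set_integralD mE fE).
rewrite (transE t1 v1)// (transE t2 v2)// opprD addrACA subrr add0r.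
apply: (bochner_increment _ _ t10 t12 int1 int2) => //.
- apply: bounded_scalar_comp; first by apply: semigroup_bounded; rewrite subr_ge0.
  exact: set_functional_bounded.
- apply: bounded_scalar_comp; first by apply: semigroup_bounded; rewrite subr_ge0.
  exact: set_functional_bounded.
- move=> s s0 st1; rewrite /l /=.
  by rewrite !semigroup_split// (le_trans st1).
- move=> s ts st; rewrite /l /= semigroup_split//; exact: cE.
Qed.

Lemma transported_mono t1 t2 : 0 <= t1 -> t1 <= t2 -> t2 <= T ->
  \forall x \ae m, Lrepr (transported t1) x <= Lrepr (transported t2) x.
Proof.
move=> t10 t12 t2T.
have : Lspace_nneg (transported t2 - transported t1).
  apply: nneg_set_integral => E mE fE.
  have -> : set_integral E (transported t2 - transported t1) =
      set_integral E (transported t2) - set_integral E (transported t1).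
    exact: set_integralB.
  rewrite -[leLHS](mulr0 (t2 - t1)); apply: transported_increment => // s ts st.
  have s0 := le_lt_trans t10 ts; have sT := le_trans st t2T.
  have [us0 fus] := superpositionP s0 sT.
  apply: set_integral_nneg => //; apply: sub_markovian_positive.
  - by apply: semigroup_bounded; rewrite subr_ge0.
  - by apply: semigroup_markov; rewrite subr_ge0.
  - by apply: filterS2 us0 fus => x ux ->; exact: (convex_ge0 f0 f_gt0).
by apply: filterS2 (LreprB (transported t2) (transported t1)) => x ->; lra.
Qed.

(** On [t1, t2] the reaction term dominates the affine minorant at
    [transported t1], because the transported solution increases. *)
Lemma transported_affine_step (al be t1 t2 : R) : 0 <= al -> 0 <= be ->
  (forall y, 0 <= y -> al * y - be <= f y) ->
  0 <= t1 -> t1 <= t2 -> t2 <= T ->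
  \forall x \ae m, Lrepr (transported t1) x +
    (t2 - t1) * (al * Lrepr (transported t1) x - be) <=
    Lrepr (transported t2) x.
Proof.
move=> al0 be0 minor t10 t12 t2T; set h := t2 - t1.
pose w := transported t2 - transported t1 - (h * al) *: transported t1.
have : \forall x \ae m, 0 <= Lrepr w x + h * be.
  apply: ae_ge_set_integral => E mE fE.
  have -> : set_integral E w = set_integral E (transported t2) -
      set_integral E (transported t1) - h * al * set_integral E (transported t1).
    by rewrite (set_integralB mE fE) (set_integralB mE fE) (set_integralZ mE fE).
  have : h * (al * set_integral E (transported t1) + - be * fine (m E)) <=
      set_integral E (transported t2) - set_integral E (transported t1).
    apply: transported_increment => // s ts st.
    have s0 := le_lt_trans t10 ts; have sT := le_trans st t2T.
    apply: set_integral_ae_le => //.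
    apply: filterS2 (transported_reaction_ge al0 be0 minor s0 sT)
      (transported_mono t10 (ltW ts) sT) => x le1 le2.
    by apply: le_trans le1; rewrite lerB// ler_wpM2l.
  move: (set_integral E (transported t2)) (set_integral E (transported t1)).
  by move=> b2 b1; lra.
apply: filterS3
  (LreprB (transported t2 - transported t1) ((h * al) *: transported t1))
  (ae_and (LreprB (transported t2) (transported t1))
    (LreprZ (h * al) (transported t1)))
  => x -> [-> ->] => le0.
change (Lrepr (transported t1) x + h * (al * Lrepr (transported t1) x - be) <=
  Lrepr (transported t2) x); lra.
Qed.

(** A supporting line at [q <= y] is at least [f q] at [y], because it increases.
    Rational points [q] below [y] are enough, since [f] is continuous from the
    left, so countably many null sets are discarded. *)
Lemma transported_euler_step t1 t2 : 0 <= t1 -> t1 <= t2 -> t2 <= T ->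
  \forall x \ae m, 0 < Lrepr (transported t1) x ->
    euler_step f (t2 - t1) (Lrepr (transported t1) x) <= Lrepr (transported t2) x.
Proof.
move=> t10 t12 t2T; set h := t2 - t1.
have h0 : 0 <= h by rewrite subr_ge0.
have rat_step (n : nat) : \forall x \ae m, forall q : rat,
    @unpickle rat n = Some q ->
    0 < (ratr q : R) -> ratr q <= Lrepr (transported t1) x ->
    Lrepr (transported t1) x + h * f (ratr q) <= Lrepr (transported t2) x.
  case: (@unpickle rat n) => [q|]; last exact: nearW.
  have [q0|q0] := ltP 0 (ratr q : R); last first.
    by apply: nearW => x _ [<-]; rewrite ltNge q0.
  have [al alq line] := convex_supporting_line f_convex f0 q0.
  have fq0 := f_gt0 q0.
  have al0 : 0 <= al by have := lt_le_trans fq0 alq; rewrite pmulr_lgt0// => /ltW.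
  have be0 : 0 <= al * ratr q - f (ratr q) by rewrite subr_ge0.
  have minor y : 0 <= y -> al * y - (al * ratr q - f (ratr q)) <= f y.
    by move=> /line; lra.
  apply: filterS (transported_affine_step al0 be0 minor t10 t12 t2T) => x step.
  move=> _ [<-] _ qx; apply: le_trans step; rewrite lerD2l ler_wpM2l//.
  by have := ler_wpM2l al0 qx; lra.
apply: filterS (ae_foralln rat_step) => x step x0.
set y := Lrepr (transported t1) x in step x0 *.
rewrite leNgt; apply/negP => lt_step.
set gap := euler_step f h y - Lrepr (transported t2) x.
have gap0 : 0 < gap by rewrite subr_gt0.
(* the Lipschitz bound for [h * f] on [0, y] *)
pose K := h * f (y + 1).
have K0 : 0 <= K by rewrite mulr_ge0// ltW// f_gt0//; lra.
have d0 : 0 < gap / (K + 1) by rewrite divr_gt0//; lra.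
have itv : Num.max 0 (y - gap / (K + 1)) < y by rewrite gt_max x0 /=; lra.
have [q] := rat_in_itvoo itv.
rewrite in_itv /= gt_max -andbA => /and3P[q0 qd qy].
have stepq := step (pickle q) q (pickleK q) q0 (ltW qy).
have lip := ler_wpM2l h0
  (convex_lipschitz f_convex f0 f_gt0 (ltW q0) (ltW qy) (lexx y)).
have : (K + 1) * (y - ratr q) < gap.
  by rewrite mulrC -ltr_pdivlMr; lra.
rewrite mulrA -/K in lip.
move: stepq lip; rewrite /gap /euler_step; lra.
Qed.

End transported_solution.

(** * Upper bound on the existence time *)

Theorem corollary4p4 (d : measure_display) (X : measurableType d)
    (R : realType) (m : {sigma_finite_measure set X -> \bar R})
    (p : R) (p1 : (1 <= p%:E)%E)
    (S : R -> {linear LspaceType m p1 -> LspaceType m p1})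
    (DL : set (LspaceType m p1)) (L : LspaceType m p1 -> LspaceType m p1)
    (hS : strongly_continuous_semigroup S)
    (hSM : sub_markovian S)
    (hL : infinitesimal_generator S DL L)
    (f : R -> R)
    (f_convex : convex_function (`[0, +oo[%classic : set R) f)
    (f_continuous : {within `[0, +oo[, continuous f})
    (f0 : f 0 = 0)
    (f_gt0 : forall s : R, 0 < s -> 0 < f s)
    (f_int : (\int[lebesgue_measure]_(s in `[1%R, +oo[) ((f s)^-1)%R%:E < +oo)%E)
    (a : LspaceType m p1) (ha : Lspace_nneg a)
    (T : R) (T_gt0 : 0 < T)
    (G : set X) (mG : measurable G) (G_gt0 : (0 < m G)%E)
    (hG : \forall x \ae m, G x -> reciprocal_tail_inv f T < Lrepr (S T a) x) :
  (~ exists u : R -> LspaceType m p1, mild_solution S f a `[0, +oo[ u) /\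
  (forall (I : set R) (u : R -> LspaceType m p1),
     is_interval I -> I `<=` `[0, +oo[ -> I 0 ->
     mild_solution S f a I u ->
     (ereal_sup [set t%:E | t in I] <= T%:E)%E).
Proof.
suff noT (I : set R) (u : R -> LspaceType m p1) :
    (forall t, 0 <= t -> t <= T -> I t) -> ~ mild_solution S f a I u.
  split=> [[u]|I u itvI I0 I00 u_mild].
    by apply: noT => t t0 _; rewrite /= in_itv /= t0.
  apply: ge_ereal_sup => _ [t It <-]; rewrite lee_fin leNgt; apply/negP => Tt.
  apply: noT u_mild => s s0 sT; apply: (itvI 0 t) => //.
  by rewrite s0 (le_trans sT)// ltW.
move=> I_T u_mild.
have [b0 Fb] := reciprocal_tail_invK f_convex f_continuous f0 f_gt0 f_int T_gt0.
(* grid with [n.+1] steps; its last time is [T], as in the one-step grid *)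
pose v (n k : nat) := transported S T u (T / n.+1%:R * k%:R).
have v0 n : v n 0%N = S T a.
  have [_ _ _ /(_ 0 (I_T 0 (lexx 0) (ltW T_gt0)))[w int_w u0]] := u_mild.
  rewrite (_ : `]0, 0]%classic = set0) in int_w; last first.
    by apply/seteqP; split => s //=; rewrite in_itv /=; lra.
  have [_ S0 _ _] := hS.
  by rewrite /v mulr0 /transported subr0 u0 S0 (bochner_integral_set0 int_w) addr0.
have vT n : v n n.+1 = v 0%N 1%N.
  by rewrite /v divfK// divr1 mulr1.
have v_step : \forall x \ae m, forall n k, (k <= n)%N -> 0 < Lrepr (v n k) x ->
    euler_step f (T / n.+1%:R) (Lrepr (v n k) x) <= Lrepr (v n k.+1) x.
  apply: ae_foralln => n; apply: ae_foralln => k.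
  have [kn|kn] := leqP k n; last exact: nearW.
  have h0 : 0 < T / n.+1%:R by rewrite divr_gt0.
  have tE : T / n.+1%:R = T / n.+1%:R * k.+1%:R - T / n.+1%:R * k%:R.
    by rewrite -mulrBr -natrB// subSnn mulr1.
  have := @transported_euler_step _ _ _ m p p1 S hS hSM f f_convex f0 f_gt0
    a T I u u_mild I_T (T / n.+1%:R * k%:R) (T / n.+1%:R * k.+1%:R).
  rewrite -tE => step; apply: filterS (step _ _ _) => [x //|||].
  - by rewrite mulr_ge0// ltW.
  - by rewrite ler_pM2l// ler_nat.
  - by rewrite mulrAC ler_pdivrMr// ler_pM2l// ler_nat.
have [N [mN N0 subN]] : \forall x \ae m, ~ G x.
  apply: filterS2 hG v_step => x hGx step Gx.
  have bx := hGx Gx.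
  have : T < reciprocal_tail f (Lrepr (S T a) x).
    apply: (euler_blowup f_convex f_continuous f0 f_gt0 f_int T_gt0
      (lt_trans b0 bx) (y := fun n k => Lrepr (v n k) x)).
    - by move=> n; rewrite v0.
    - by move=> n; rewrite vT.
    - exact: step.
  rewrite ltNge -{2}Fb => /negP; apply.
  exact: (reciprocal_tail_mono f_convex f_continuous f0 f_gt0 f_int b0 (ltW bx)).
have : (m G <= m N)%E.
  apply: (le_measure m (mem_set mG) (mem_set mN)) => x Gx.
  by apply: subN => /=; apply.
by rewrite N0 leNgt G_gt0.
Qed.
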